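(* Let $n\geq 0$ and $s\geq 0$ be integers, and let $f$, $g$, $\varphi$ be functions of one (real or complex) variable with derivatives of high enough order ($f$ and $g$ being $n$ times differentiable and $\varphi$ being $n+s$ times differentiable), such that the compositions $f\circ\varphi$ and $g\circ\varphi^{(s)}$ are defined. Then the $n$th derivative of $(f\circ\varphi)\cdot\big(g\circ\varphi^{(s)}\big)$ is $$\sum_{r\geq0}\ \sum_{\lambda \vdash n+rs}\frac{n!\,e_{r}\big((\lambda^{>s})_{s}\big)}{\prod_{i\geq1}(i!)^{m_{i}}m_{i}!}\big(f^{(\ell(\lambda)-r)}\circ\varphi\big)\big(g^{(r)}\circ\varphi^{(s)}\big)\prod_{i\geq1}\big(\varphi^{(i)}\big)^{m_{i}},$$ where $m_i=m_i(\lambda)$ and where terms with $e_{r}\big((\lambda^{>s})_{s}\big)=0$ are understood to be $0$. Moreover, this expression coincides with $$\sum_{r=0}^{n}\ \sum_{\substack{\lambda \vdash n+rs \\ \ell(\lambda^{>s}) \geq r}}\frac{n!\,e_{r}\big((\lambda^{>s})_{s}\big)}{\prod_{i\geq1}(i!)^{m_{i}}m_{i}!}\big(f^{(\ell(\lambda)-r)}\circ\varphi\big)\big(g^{(r)}\circ\varphi^{(s)}\big)\prod_{i\geq1}\big(\varphi^{(i)}\big)^{m_{i}},$$ in which the restrictions $r\leq n$ and $\ell(\lambda^{>s})\geq r$ are imposed, and it is therefore a finite sum.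
   Context: A partition $\lambda$ is a finite weakly decreasing sequence of positive integers $a_1,\dots,a_L$ (the empty partition is allowed). Its length is $\ell(\lambda)=L$, and $|\lambda|=\sum_l a_l$; $\lambda\vdash N$ means $|\lambda|=N$. For $i\geq1$ the multiplicity $m_i=m_i(\lambda)$ is the number of indices $l$ with $a_l=i$. For an integer $s\geq0$, $\lambda^{>s}$ is the partition obtained from $\lambda$ by deleting all parts $a_l\leq s$. For a non-negative integer $a$, $(a)_s=\prod_{\upsilon=0}^{s-1}(a-\upsilon)$ (falling factorial, $(a)_0=1$). For a partition $\mu$, $(\mu)_s$ is the finite sequence obtained by replacing each part $a_l$ of $\mu$ by $(a_l)_s$. For $r\geq0$, $e_r$ of a finite sequence of numbers is the $r$th elementary symmetric function of its entries, with $e_0=1$ and $e_r=0$ if the sequence has fewer than $r$ entries. $\varphi^{(s)}$ denotes the $s$th derivative, with $\varphi^{(0)}=\varphi$. *)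

(* Defs.v *)
From mathcomp Require Import all_boot all_order all_algebra.
From mathcomp Require Import all_classical all_reals all_analysis.

Set Implicit Arguments.
Unset Strict Implicit.
Unset Printing Implicit Defensive.

Import Order.TTheory GRing.Theory Num.Theory.
Import numFieldNormedType.Exports.

Local Open Scope ring_scope.
Local Open Scope classical_set_scope.

(* Functions on a domain D are represented by total functions whose values
   outside D are irrelevant. For D open, the iterated derivatives on D depend
   only on the values on D. The n-th derivative on D exists once the
   derivatives of order k < n are derivable at every point of D. *)
Definition ntimes_derivable (K : numFieldType) (n : nat) (D : set K)
    (h : K -> K) : Prop :=
  forall (k : nat) (x : K), (k < n)%N -> D x -> derivable (derive1n k h) x 1.

Definition partition_of (N : nat) : set (seq nat) :=
  [set la | [/\ sorted geq la, 0%N \notin la & sumn la = N]].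

Definition parts_gt (s : nat) (la : seq nat) : seq nat :=
  [seq a <- la | (s < a)%N].

Definition falling_parts (s : nat) (mu : seq nat) : seq nat :=
  [seq a ^_ s | a <- mu].

Definition elem_sym (r : nat) (a : seq nat) : nat :=
  (\sum_(I : {set 'I_(size a)} | #|I| == r) \prod_(i in I) nth 0 a i)%N.

(* Products over all i >= 1 stop at sumn la, since no part exceeds it: the
   remaining factors have multiplicity 0 and are equal to 1. The subtraction
   in [size la - r] is truncated only when the elementary symmetric function
   is 0, and then the whole term is 0. The quotient is taken in K. *)
Definition term (K : numFieldType) (f g phi : K -> K) (n s r : nat)
    (la : seq nat) (x : K) : K :=
  (n`! * elem_sym r (falling_parts s (parts_gt s la)))%:R
  / (\prod_(1 <= i < (sumn la).+1) (i`! ^ count_mem i la * (count_mem i la)`!))%:R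
  * derive1n (size la - r) f (phi x)
  * derive1n r g (derive1n s phi x)
  * \prod_(1 <= i < (sumn la).+1) derive1n i phi x ^+ count_mem i la.

(* Main.v *)
(** Put u = phi and v = phi^(s), and let
      A(t) = sum_(i >= 1) u^(i)(x) t^i / i!,  B(t) = sum_(j >= 1) v^(j)(x) t^j / j!
    be the formal increments of u and v at x. Differentiating coefficients in x
    gives dA/dx = A'(t) - u'(x) and dB/dx = B'(t) - v'(x). Hence, by induction on n
    and a telescoping cancellation, the n-th derivative of (f o u) (g o v) is
      sum_(k, r) n! [t^n] (A^k / k!) (B^r / r!) f^(k)(u) g^(r)(v).
    Since v^(j) = u^(s + j), t^s B(t) is C(t) = sum_(a > s) (a)_s u^(a)(x) t^a / a!,
    so [t^n] A^k B^r = [t^(n + r s)] A^k C^r. Finally A^k C^r / (k! r!) is the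
    coefficient of y^r in (A + y C)^(k + r) / (k + r)!, which the multinomial theorem
    expands over the partitions la with k + r parts; there y^r comes from
    prod_(a in la) (1 + y w_a), w_a = (a)_s if a > s and 0 otherwise, and contributes
    the elementary symmetric function e_r. *)
Require Import Defs.
From mathcomp Require Import all_boot all_order all_algebra.
From mathcomp Require Import all_classical all_reals all_analysis.
From mathcomp Require Import ring.

Set Implicit Arguments.
Unset Strict Implicit.
Unset Printing Implicit Defensive.

Import Order.TTheory GRing.Theory Num.Theory.
Import numFieldNormedType.Exports.

Local Open Scope ring_scope.
Local Open Scope classical_set_scope.

(** * Partitions and the multinomial theorem *)

(** The recursion picks the multiplicity [j] of the largest allowed part, to match the binomial
    expansion in [multinomial_partitions]. Here [l] counts the parts; their sum is left free. *)
Fixpoint bounded_partitions (M l : nat) : seq (seq nat) :=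
  if M is M'.+1 then
    [seq nseq j M'.+1 ++ la | j <- iota 0 l.+1,
                              la <- bounded_partitions M' (l - j)]
  else if l is 0%N then [:: [::]] else [::].

Lemma bounded_partitionsS M l : bounded_partitions M.+1 l =
  [seq nseq j M.+1 ++ la | j <- iota 0 l.+1,
                           la <- bounded_partitions M (l - j)].
Proof. by []. Qed.

Lemma path_geq_nseq j (x : nat) la :
  path geq x (nseq j x ++ la) = path geq x la.
Proof. by elim: j => //= j ->; rewrite /= leqnn. Qed.

Lemma sorted_geq_nseq j (x : nat) la :
  all (fun a => a <= x)%N la -> sorted geq la -> sorted geq (nseq j x ++ la).
Proof.
by case: j => //= j lela sla; rewrite path_geq_nseq path_min_sorted.
Qed.

Lemma mem_bounded_partitions M l la :
  (la \in bounded_partitions M l) =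
  [&& sorted geq la, all (fun a => 0 < a <= M)%N la & size la == l].
Proof.
elim: M l la => [|M IH] l la.
  case: l => [|l]; first by case: la => [|[|a] la]; rewrite ?inE //= ?andbF.
  by case: la => [|[|a] la]; rewrite ?inE //= ?andbF.
rewrite bounded_partitionsS; apply/allpairsPdep/idP => [[j [mu [+ + ->]]]|].
  rewrite mem_iota add0n ltnS IH /= => jl /and3P[smu amu /eqP zmu].
  rewrite size_cat size_nseq zmu subnKC // eqxx andbT sorted_geq_nseq //=.
    rewrite all_cat all_nseq /= leqnn orbT /=.
    by apply: sub_all amu => a /andP[-> /= /leqW].
  by apply: sub_all amu => a /andP[_ /leqW].
move=> /and3P[sla ala /eqP zla].
(* Length of the initial run of parts equal to [M.+1]; sortedness puts all of them there. *)
pose j := find (fun a => a != M.+1) la.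
have jl : (j <= l)%N by rewrite -zla find_size.
have tla : take j la = nseq j M.+1.
  apply: (@eq_from_nth _ 0%N) => [|i]; first by rewrite size_takel ?zla ?size_nseq.
  rewrite size_takel ?zla // => ij; rewrite nth_take // nth_nseq ij.
  by apply/eqP; have := before_find 0%N ij => /negbFE.
exists j, (drop j la); split; first by rewrite mem_iota add0n ltnS.
  rewrite IH size_drop zla eqxx andbT drop_sorted //=.
  have sdla : sorted geq (drop j la) by rewrite drop_sorted.
  have adla : all (fun a => 0 < a <= M.+1)%N (drop j la).
    by apply/allP => a /mem_drop; move: a; apply/allP.
  case ed : (drop j la) => [//|b t] /=; rewrite ed /= in sdla adla.
  have bM : (b <= M)%N.
    have : nth 0%N la j != M.+1.
      apply: (@nth_find _ 0%N (fun a => a != M.+1)).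
      by rewrite has_find -subn_gt0 -size_drop ed.
    have -> : nth 0%N la j = b by rewrite -[j]addn0 -nth_drop ed.
    by move: adla => /= /andP[/andP[_ +] _] bn; rewrite leq_eqVlt (negbTE bn).
  move: adla => /andP[/andP[-> _] at_]; rewrite bM /=.
  have tr_geq : transitive geq by move=> y x z yx zy; exact: leq_trans zy yx.
  have /allP tb := order_path_min tr_geq sdla.
  apply/allP => a ta; move/allP: at_ => /(_ _ ta)/andP[-> _].
  exact: leq_trans (tb _ ta) bM.
by rewrite -tla cat_take_drop.
Qed.

Lemma bounded_partitions_count M l la :
  la \in bounded_partitions M l -> count_mem M.+1 la = 0%N.
Proof.
rewrite mem_bounded_partitions => /and3P[_ /allP ala _].
by apply/count_memPn/negP => /ala /andP[_]; rewrite ltnn.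
Qed.

Lemma bounded_partitions_uniq M l : uniq (bounded_partitions M l).
Proof.
elim: M l => [|M IH] l; first by case: l.
rewrite bounded_partitionsS; apply: allpairs_uniq_dep => //.
- exact: iota_uniq.
- move=> [i x] [j y] /allpairsPdep[i' [x' [_ x'in [-> ->]]]].
  move=> /allpairsPdep[j' [y' [_ y'in [-> ->]]]] /= e.
  (* The multiplicity of [M.+1] recovers the index, since the tails do not contain that part. *)
  have eij : i' = j'.
    have /(congr1 (count_mem M.+1)) := e.
    rewrite !count_cat !count_nseq /= eqxx !mul1n.
    rewrite (bounded_partitions_count x'in).
    by rewrite (bounded_partitions_count y'in) !addn0.
  move: e x'in y'in; rewrite eij => e _ _; congr existT.
  by have /(congr1 (drop j')) := e; rewrite !drop_size_cat ?size_nseq.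
Qed.

Section Multinomial.
Variables (K : numFieldType) (R : comNzRingType) (inK : {rmorphism K -> R}).
Variable b : nat -> R.

(** Induction on [M]: the binomial theorem isolates [b M.+1], whose exponent is the multiplicity of
    the part [M.+1]. The map [inK] carries inverse factorials into a ring that need not be a field,
    such as polynomials in two variables. *)
Lemma multinomial_partitions M l :
  inK (l`!%:R^-1) * (\sum_(1 <= i < M.+1) b i) ^+ l =
  \sum_(la <- bounded_partitions M l)
    inK ((\prod_(1 <= i < M.+1) (count_mem i la)`!)%:R^-1)
    * \prod_(1 <= i < M.+1) b i ^+ count_mem i la.
Proof.
elim: M l => [|M IH] l.
  rewrite big_geq // expr0n; case: l => [|l] /=; last by rewrite big_nil mulr0.
  by rewrite big_seq1 !big_geq // fact0 mulr1.
rewrite big_nat_recr // exprDn bounded_partitionsS big_allpairs_dep.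
rewrite mulr_sumr; have -> : iota 0 l.+1 = index_iota 0 l.+1.
  by rewrite /index_iota subn0.
rewrite big_mkord; apply: eq_bigr => j _.
have jl : (j <= l)%N by rewrite -ltnS.
have lf : (l`!%:R^-1 *+ 'C(l, j) : K) = (l - j)`!%:R^-1 * j`!%:R^-1.
  have f0 k : k`!%:R != 0 :> K by rewrite pnatr_eq0 -lt0n fact_gt0.
  have c0 : 'C(l, j)%:R != 0 :> K by rewrite pnatr_eq0 -lt0n bin_gt0.
  rewrite -[in LHS](bin_fact jl) [in LHS]natrM [(j`! * _)%:R]natrM !invfM.
  by rewrite -[LHS]mulr_natr mulrAC mulVf // mul1r mulrC.
rewrite mulrnAr mulrA -mulrnAl -mulrnAl -rmorphMn /= lf rmorphM /=.
rewrite -[LHS]mulrA mulrACA IH mulr_suml.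
rewrite !big_seq; apply: eq_bigr => la laP.
have c1 : count_mem M.+1 (nseq j M.+1 ++ la) = j.
  by rewrite count_cat count_nseq /= eqxx (bounded_partitions_count laP) mul1n addn0.
have c2 i : (i < M.+1)%N -> count_mem i (nseq j M.+1 ++ la) = count_mem i la.
  by move=> iM; rewrite count_cat count_nseq /= gtn_eqF // mul0n.
have e1 : (\prod_(1 <= i < M.+1) (count_mem i (nseq j M.+1 ++ la))`! =
    \prod_(1 <= i < M.+1) (count_mem i la)`!)%N.
  by apply: eq_big_nat => i /andP[_ iM]; rewrite c2.
have e2 : \prod_(1 <= i < M.+1) b i ^+ count_mem i (nseq j M.+1 ++ la) =
    \prod_(1 <= i < M.+1) b i ^+ count_mem i la.
  by apply: eq_big_nat => i /andP[_ iM]; rewrite c2.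
rewrite !(big_nat_recr M.+1) // !c1 e1 e2.
rewrite natrM invfM rmorphM /=.
exact: mulrACA.
Qed.
End Multinomial.

Lemma prod_exp_count (R : comNzRingType) (F : nat -> R) M la :
  all (fun a => 0 < a <= M)%N la ->
  \prod_(1 <= i < M.+1) F i ^+ count_mem i la = \prod_(a <- la) F a.
Proof.
elim: la => [|a la IH] /=; first by rewrite big_nil big1.
move=> /andP[aM ala]; rewrite big_cons -(IH ala).
under eq_bigr do rewrite exprD.
rewrite big_split /=; congr (_ * _).
rewrite (bigD1_seq a) ?iota_uniq ?mem_index_iota ?ltnS //= eqxx expr1 big1 ?mulr1 //.
by move=> i ai; rewrite eq_sym (negbTE ai).
Qed.

(** The extra factors are all [0]! = 1. This reconciles the range of [term], which stops at
    [sumn la], with a bound common to all partitions. *)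
Lemma prod_fact_count_widen M N la : (M <= N)%N ->
  all (fun a => 0 < a <= M)%N la ->
  (\prod_(1 <= i < N.+1) (count_mem i la)`! =
   \prod_(1 <= i < M.+1) (count_mem i la)`!)%N.
Proof.
move=> MN /allP ala; rewrite (big_cat_nat (n := M.+1)) //=.
rewrite [X in (_ * X)%N]big_nat [X in (_ * X)%N]big1 ?muln1 // => i /andP[Mi _].
suff -> : count_mem i la = 0%N by [].
by apply/count_memPn/negP => /ala /andP[_]; rewrite leqNgt Mi.
Qed.

(** * Elementary symmetric functions as polynomial coefficients *)

Lemma elem_sym_coef (K : numFieldType) r c :
  (elem_sym r c)%:R = (\prod_(x <- c) (1 + x%:R *: 'X))`_r :> K.
Proof.
rewrite (big_nth 0%N) big_mkord (eq_bigr (fun i : 'I_(size c) =>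
  ((nth 0%N c i)%:R *: 'X : {poly K}) + 1)); last by move=> i _; rewrite addrC.
rewrite bigA_distr coef_sum /elem_sym natr_sum.
rewrite [RHS](bigID (fun I : {set _} => #|I| == r)) /=.
rewrite [X in _ = _ + X]big1 ?addr0 => [|I /negbTE Ir].
  apply: eq_bigr => I /eqP Ir; rewrite -big_mkcond /= scaler_prod prodr_const Ir.
  by rewrite coefZ coefXn eqxx mulr1 natr_prod.
by rewrite -big_mkcond /= scaler_prod prodr_const coefZ coefXn eq_sym Ir mulr0.
Qed.

(** For [a < s] the falling factorial is already 0. The test matters at [a = s], where it equals
    [s]! although [parts_gt] discards the part. *)
Definition falling_weight (s a : nat) : nat := if (s < a)%N then a ^_ s else 0.

(** A deleted part has weight 0, so its factor is 1 and the product may run over all of [la]. *)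
Lemma elem_sym_falling_parts_coef (K : numFieldType) s r la :
  (elem_sym r (falling_parts s (parts_gt s la)))%:R
  = (\prod_(x <- la) (1 + (falling_weight s x)%:R *: 'X))`_r :> K.
Proof.
rewrite elem_sym_coef /falling_parts big_map big_filter.
apply: (congr1 (fun p : {poly K} => p`_r)).
rewrite big_mkcond /=; apply: eq_bigr => x _; rewrite /falling_weight.
by case: ifP => // _; rewrite scale0r addr0.
Qed.

Section CoefPartitionSum.
Variables (K : numFieldType) (a w : nat -> K) (M : nat).

Let A : {poly K} := \sum_(1 <= i < M.+1) a i *: 'X^i.
Let C : {poly K} := \sum_(1 <= i < M.+1) (w i * a i) *: 'X^i.

(** The multinomial theorem is applied to the variables [a i] t^i (1 + [w i] y), whose sum is A + y
    C; the coefficient of y^r t^m is then read off on both sides. *)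
Lemma coef_partition_sum l r m : (r <= l)%N ->
  (A ^+ (l - r) * C ^+ r)`_m / ((l - r)`! * r`!)%:R =
  \sum_(la <- bounded_partitions M l | sumn la == m)
    (\prod_(x <- la) (1 + w x *: 'X))`_r
     * (\prod_(1 <= i < M.+1) (count_mem i la)`!)%:R^-1
     * \prod_(x <- la) a x.
Proof.
move=> rl.
(* The outer variable is y, the inner one t. *)
pose b i : {poly {poly K}} :=
  (a i *: 'X^i)%:P * map_poly polyC (1 + w i *: 'X).
have := multinomial_partitions (polyC \o polyC) b M l.
have -> : \sum_(1 <= i < M.+1) b i = A%:P + C%:P * 'X.
  rewrite /A /C !rmorph_sum /= mulr_suml -big_split /=; apply: eq_bigr => i _.
  rewrite /b rmorphD rmorph1 /= map_polyZ /= map_polyX mulrDr mulr1; congr (_ + _).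
  rewrite -mul_polyC mulrA -polyCM; congr (_%:P * _).
  by rewrite mulrC mul_polyC scalerA.
move=> /(congr1 (fun p : {poly {poly K}} => p`_r`_m)) /=.
rewrite coefCM coefCM exprDn coef_sum.
(* Only the binomial term of index [r] has degree [r] in y. *)
rewrite (bigD1 (Ordinal (n := l.+1) (m := r) rl)) //= big1 ?addr0; last first.
  move=> i ir; rewrite exprMn mulrA -!polyC_exp -polyCM coefMn coefCM coefXn.
  by rewrite -val_eqE /= eq_sym in ir; rewrite (negbTE ir) mulr0 mul0rn.
rewrite exprMn mulrA -!polyC_exp -polyCM coefMn coefCM coefXn eqxx mulr1 coefMn.
rewrite -[X in _ * X]mulr_natr mulrCA.
have -> : l`!%:R^-1 * 'C(l, r)%:R = ((l - r)`! * r`!)%:R^-1 :> K.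
  rewrite -(bin_fact rl) [in LHS]natrM invfM mulrAC mulVf ?mul1r; last first.
    by rewrite pnatr_eq0 -lt0n bin_gt0.
  by rewrite [in LHS]mulnC.
move=> ->; rewrite !coef_sum [RHS]big_mkcond /= !big_seq; apply: eq_bigr => la laP.
have ala : all (fun a => 0 < a <= M)%N la.
  by move: laP; rewrite mem_bounded_partitions => /and3P[].
rewrite coefCM coefCM (prod_exp_count b ala) /b big_split /=.
rewrite -!rmorph_prod /= coefCM coef_map /= coefMC.
rewrite (eq_bigr (fun i => (a i)%:P * 'X^i)) => [|i _]; last by rewrite mul_polyC.
rewrite big_split /= -rmorph_prod /= coefCM.
have -> : \prod_(i <- la) 'X^i = 'X^(sumn la) :> {poly K}.
  by rewrite sumnE; elim: (la) => [|i t IH]; rewrite ?big_nil ?big_cons ?exprD ?IH.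
(* Extracting the coefficient of t^m imposes the condition [sumn la == m]. *)
rewrite coefXn eq_sym; case: ifP => _; last by rewrite mulr0 mul0r mulr0.
rewrite mulr1.
by rewrite [X in _ * X = _]mulrC mulrCA mulrA.
Qed.
End CoefPartitionSum.

(** * Derivatives of products of compositions *)

(* The family of polynomials p is differentiated coefficientwise at x, but only
   up to degree n: the higher coefficients of [taylor_increment] involve
   derivatives that need not exist. *)
Section CoefDerivative.
Variables (K : numFieldType) (x : K).

Definition is_derive_coef (n : nat) (p : K -> {poly K}) (dp : {poly K}) :=
  forall i, (i <= n)%N -> is_derive x 1 (fun y => (p y)`_i) dp`_i.

Lemma is_derive_coef1 n : is_derive_coef n (fun=> 1) 0.
Proof. by move=> i _; rewrite coef0; exact: is_derive_cst. Qed.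

(** Degree [i] of a product involves only degrees at most [i] of the factors, so the truncation at
    [n] is compatible with the Leibniz rule. *)
Lemma is_derive_coefM n (p q : K -> {poly K}) dp dq :
  is_derive_coef n p dp -> is_derive_coef n q dq ->
  is_derive_coef n (fun y => p y * q y) (dp * q x + p x * dq).
Proof.
move=> hp hq i ni.
have -> : (fun y => (p y * q y)`_i) =
    \sum_(j < i.+1) ((fun y => (p y)`_j) * (fun y => (q y)`_(i - j))).
  by apply/funext => y; rewrite coefM fct_sumE.
rewrite coefD !coefM -big_split /=; apply: is_derive_sum => j.
have jn : (j <= n)%N by rewrite (leq_trans _ ni) // -ltnS.
have ijn : (i - j <= n)%N by rewrite (leq_trans _ ni) // leq_subr.
have ? := hp _ jn; have ? := hq _ ijn.
by apply: is_derive_eq; rewrite addrC /GRing.scale /= [_ * dp`_j]mulrC.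
Qed.

Lemma is_derive_coefX n (p : K -> {poly K}) dp k :
  is_derive_coef n p dp ->
  is_derive_coef n (fun y => p y ^+ k) (p x ^+ k.-1 * dp *+ k).
Proof.
move=> hp; elim: k => [|k IH]; first exact: is_derive_coef1.
have := is_derive_coefM hp IH; congr (is_derive_coef _ _ _).
  by apply/funext => y; rewrite exprS.
rewrite mulrS mulrC; congr (_ + _); case: (k) => [|m].
  by rewrite !mulr0n mulr0.
by rewrite -mulrnAr mulrA -exprS -mulrnAr.
Qed.

End CoefDerivative.

Section DerivativeRules.
Variable K : numFieldType.

(** In one variable derivability is differentiability and the derivative is the differential at 1,
    so the chain rule for differentials applies. *)
Lemma is_derive1_comp (h u : K -> K) (x dh du : K) :
  is_derive x 1 u du -> is_derive (u x) 1 h dh ->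
  is_derive x 1 (h \o u) (dh * du).
Proof.
move=> [/derivable1_diffP du1 u1] [/derivable1_diffP dh1 h1].
have d : differentiable (h \o u) x by exact: differentiable_comp.
apply: DeriveDef; first exact/derivable1_diffP.
have u1' : 'd u x 1 = du by rewrite -deriveE.
have h1' : 'd h (u x) 1 = dh by rewrite -deriveE.
rewrite deriveE // diff_comp //= u1' -[du]mulr1.
by rewrite [LHS]linearZ /= h1' mulr1 mulrC.
Qed.

Lemma ntimes_is_derive n (D : set K) h k x : ntimes_derivable n D h ->
  (k < n)%N -> D x -> is_derive x 1 (derive1n k h) (derive1n k.+1 h x).
Proof.
move=> dh kn Dx; apply: DeriveDef; first exact: dh.
by rewrite derive1nS derive1E.
Qed.

Lemma derive1nD j k (h : K -> K) : derive1n j (derive1n k h) = derive1n (j + k) h.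
Proof. by rewrite /derive1n iterD. Qed.

Lemma ntimes_derivable_derive1n n s D (h : K -> K) :
  ntimes_derivable (n + s) D h -> ntimes_derivable n D (derive1n s h).
Proof. by move=> dh k x kn Dx; rewrite derive1nD; apply: dh; rewrite ?ltn_add2r. Qed.

Lemma ntimes_derivableW m n D (h : K -> K) : (m <= n)%N ->
  ntimes_derivable n D h -> ntimes_derivable m D h.
Proof. by move=> mn dh k x km; apply: dh; exact: leq_trans mn. Qed.

End DerivativeRules.

Lemma coef_sum_scaleXn (R : nzRingType) (c : nat -> R) M i :
  (\sum_(1 <= j < M.+1) c j *: 'X^j)`_i = if (0 < i <= M)%N then c i else 0.
Proof.
rewrite coef_sum; case: ifPn => iM.
  rewrite (bigD1_seq i) ?mem_index_iota ?iota_uniq //= coefZ coefXn eqxx mulr1.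
  by rewrite big1 ?addr0 // => j ji; rewrite coefZ coefXn eq_sym (negbTE ji) mulr0.
rewrite big_nat big1 // => j jM; rewrite coefZ coefXn; case: eqP => [e|_].
  by rewrite e jM in iM.
by rewrite mulr0.
Qed.

(** * Formal Taylor increments *)

Section TaylorIncrement.
Variable K : numFieldType.

Definition taylor_increment (M : nat) (h : K -> K) (x : K) : {poly K} :=
  \sum_(1 <= i < M.+1) (derive1n i h x / i`!%:R) *: 'X^i.

Lemma coef_taylor_increment M h x i : (taylor_increment M h x)`_i =
  if (0 < i <= M)%N then derive1n i h x / i`!%:R else 0.
Proof. exact: coef_sum_scaleXn. Qed.

(** Increments have no constant term, so ['X^(k + r)] divides the product. *)
Lemma coef_taylor_increment_expM M1 M2 h1 h2 x k r n : (n < k + r)%N ->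
  (taylor_increment M1 h1 x ^+ k * taylor_increment M2 h2 x ^+ r)`_n = 0.
Proof.
have E M h : exists q, taylor_increment M h x = q * 'X.
  exists (\sum_(1 <= i < M.+1) (derive1n i h x / i`!%:R) *: 'X^(i.-1)).
  rewrite mulr_suml; apply: eq_big_nat => i /andP[i0 _].
  by rewrite -scalerAl -exprSr prednK.
have [q1 ->] := E M1 h1; have [q2 ->] := E M2 h2.
by move=> nkr; rewrite !exprMn mulrACA -exprD coefMXn nkr.
Qed.

(** The derivative of h^(i) / i! is (i + 1) h^(i+1) / (i + 1)!, a coefficient of the formal
    derivative. In degree 0 the increment vanishes, so the constant h' has to be subtracted. The
    bound [N <= M] keeps degree i + 1 within the truncation. *)
Lemma is_derive_coef_taylor_increment M N n (D : set K) h x :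
  ntimes_derivable N D h -> (N <= M)%N -> (n < N)%N -> D x ->
  is_derive_coef x n (taylor_increment M h)
    ((taylor_increment M h x)^`() - (derive1n 1 h x)%:P).
Proof.
move=> dh NM nN Dx i ni.
have -> : (fun y => (taylor_increment M h y)`_i) =
    (fun y => if (0 < i <= M)%N then derive1n i h y / i`!%:R else 0).
  by apply/funext => y; rewrite coef_taylor_increment.
have iN : (i < N)%N := leq_ltn_trans ni nN.
have iM : (i < M)%N := leq_trans iN NM.
rewrite coefB coef_deriv coefC coef_taylor_increment ltnS leq0n iM /=.
rewrite (ltnW iM) andbT.
case: i ni iN iM => [|i] ni iN iM /=.
  rewrite mulr1n divr1 subrr; exact: is_derive_cst.
have ? := ntimes_is_derive dh iN Dx.
have -> : (fun y => derive1n i.+1 h y / (i.+1)`!%:R) =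
   (i.+1)`!%:R^-1 \*: derive1n i.+1 h.
  by apply/funext => y /=; rewrite mulrC.
apply: is_derive_eq.
rewrite subr0 -[RHS]mulr_natr [(i.+2)`!]factS (natrM _ i.+2) invfM /GRing.scale /=.
rewrite mulrA mulrAC divfK ?pnatr_eq0 // mulrC //.
Qed.

End TaylorIncrement.

(** Since k / k! = 1 / (k - 1)!, consecutive terms cancel; at [k = 0] the truncated predecessor is
    multiplied by 0. *)
Lemma sum_telescope (K : numFieldType) (u v : nat -> K) L :
  \sum_(k < L.+1) (k`!%:R^-1 * (u k * v k.+1 - u k.-1 * v k *+ k)) =
  L`!%:R^-1 * (u L * v L.+1).
Proof.
elim: L => [|L IH]; first by rewrite big_ord1 mulr0n subr0.
rewrite big_ord_recr /= IH mulrBr addrCA -[RHS]addr0; congr (_ + _).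
apply/eqP; rewrite subr_eq0; apply/eqP.
rewrite [(L.+1)`!]factS (natrM _ L.+1) invfM mulrnAr -mulrnAl.
congr (_ * _).
by rewrite -[RHS]mulr_natr mulrAC mulVf ?mul1r // pnatr_eq0.
Qed.

Section CompositionFormula.
Variables (K : numFieldType) (N Mu Mv Lu Lv : nat).
Variables (f g u v : K -> K) (U V W : set K).
Hypotheses (oU : open U) (uV : forall x, U x -> V (u x))
  (vW : forall x, U x -> W (v x)).
Hypotheses (df : ntimes_derivable N V f) (dg : ntimes_derivable N W g)
  (du : ntimes_derivable N U u) (dv : ntimes_derivable N U v).
Hypotheses (NMu : (N <= Mu)%N) (NMv : (N <= Mv)%N)
  (NLu : (N <= Lu)%N) (NLv : (N <= Lv)%N).

Let P k r x := taylor_increment Mu u x ^+ k * taylor_increment Mv v x ^+ r.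
Let H x := f (u x) * g (v x).
(** The candidate for the [n]-th derivative. Terms with [k + r > n] vanish, so the bounds only have
    to reach [N] and can be chosen later. *)
Let F n x := \sum_(k < Lu.+1) \sum_(r < Lv.+1)
  n`!%:R / (k`! * r`!)%:R * (P k r x)`_n
  * derive1n k f (u x) * derive1n r g (v x).

Let DP n k r x := (P k r x)`_n.+1 *+ n.+1
  - derive1n 1 u x * (P k.-1 r x)`_n *+ k
  - derive1n 1 v x * (P k r.-1 x)`_n *+ r.

(** The first term of [DP] comes from the formal derivative of [P k r], the other two from the
    constants subtracted in the derivatives of the two increments. *)
Lemma is_derive_coef_product n k r x : (n < N)%N -> U x ->
  is_derive x 1 (fun y => (P k r y)`_n) (DP n k r x).
Proof.
move=> nN Ux.
have hu := is_derive_coefX k (is_derive_coef_taylor_increment du NMu nN Ux).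
have hv := is_derive_coefX r (is_derive_coef_taylor_increment dv NMv nN Ux).
apply: (is_derive_eq (is_derive_coefM hu hv (leqnn n))); rewrite /DP /P.
set A := taylor_increment Mu u x; set B := taylor_increment Mv v x.
rewrite -coef_deriv -!coefCM -!coefMn -!coefB derivM !deriv_exp.
apply: (congr1 (fun p : {poly K} => p`_n)).
ring.
Qed.

(* For k + r > n, f^(k) or g^(r) need not be derivable, but then the function
   is constantly 0 because t divides both increments. *)
Lemma is_derive_summand n k r x : (n < N)%N -> U x ->
  is_derive x 1
    (fun y => (P k r y)`_n * derive1n k f (u y) * derive1n r g (v y))
    (DP n k r x * derive1n k f (u x) * derive1n r g (v x)
     + (P k r x)`_n * derive1n 1 u x * derive1n k.+1 f (u x) * derive1n r g (v x)
     + (P k r x)`_n * derive1n 1 v x * derive1n k f (u x) * derive1n r.+1 g (v x)).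
Proof.
move=> nN Ux; have hP := is_derive_coef_product k r nN Ux.
have [nkr|krn] := ltnP n (k + r).
  have P0 y : (P k r y)`_n = 0 by exact: coef_taylor_increment_expM.
  have D0 : DP n k r x = 0.
    have eP : (fun y => (P k r y)`_n) = cst 0 by apply/funext.
    by rewrite eP in hP; have [_ <-] := hP; rewrite derive_cst.
  rewrite (_ : (fun y => _) = cst 0).
    by rewrite D0 P0 !mul0r !addr0; exact: is_derive_cst.
  by apply/funext => y; rewrite P0 !mul0r.
have kN : (k < N)%N by apply: leq_ltn_trans nN; exact: leq_trans (leq_addr _ _) krn.
have rN : (r < N)%N by apply: leq_ltn_trans nN; exact: leq_trans (leq_addl _ _) krn.
have N0 : (0 < N)%N by exact: leq_ltn_trans nN.
have hu := ntimes_is_derive du N0 Ux.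
have hv := ntimes_is_derive dv N0 Ux.
have hf := is_derive1_comp hu (ntimes_is_derive df kN (uV Ux)).
have hg := is_derive1_comp hv (ntimes_is_derive dg rN (vW Ux)).
rewrite (_ : (fun y => _) =
  ((fun y => (P k r y)`_n) * (derive1n k f \o u)) * (derive1n r g \o v)) //.
apply: is_derive_eq.
rewrite /GRing.scale /=.
rewrite mulrfctE /=.
ring.
Qed.

(** Termwise differentiation yields [F n.+1] and two error sums, one telescoping in [k], the other
    in [r]. Their boundary terms carry a coefficient of degree [n] with [n < Lu] or [n < Lv], hence
    vanish. *)
Lemma is_derive_composition_sum n x : (n < N)%N -> U x ->
  is_derive x 1 (F n) (F n.+1 x).
Proof.
move=> nN Ux.
have -> : F n = \sum_(k < Lu.+1) \sum_(r < Lv.+1) (n`!%:R / (k`! * r`!)%:R) \*: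
    (fun y => (P k r y)`_n * derive1n k f (u y) * derive1n r g (v y)).
  apply/funext => y; rewrite !fct_sumE; apply: eq_bigr => k _.
  by rewrite fct_sumE; apply: eq_bigr => r _ /=; rewrite /GRing.scale /= !mulrA.
have h k r := is_derive_summand k r nN Ux.
apply: is_derive_eq.
rewrite /GRing.scale /=.
transitivity (F n.+1 x
  + \sum_(r < Lv.+1) (n`!%:R / r`!%:R * derive1n 1 u x * derive1n r g (v x)) *
      \sum_(k < Lu.+1) k`!%:R^-1 * ((P k r x)`_n * derive1n k.+1 f (u x)
        - (P k.-1 r x)`_n * derive1n k f (u x) *+ k)
  + \sum_(k < Lu.+1) (n`!%:R / k`!%:R * derive1n 1 v x * derive1n k f (u x)) *
      \sum_(r < Lv.+1) r`!%:R^-1 * ((P k r x)`_n * derive1n r.+1 g (v x)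
        - (P k r.-1 x)`_n * derive1n r g (v x) *+ r)).
  rewrite [X in _ + X + _](eq_bigr _ (fun r _ => mulr_sumr _ _ _ _)).
  rewrite [X in _ + X + _]exchange_big /=.
  rewrite [X in _ = _ + X](eq_bigr _ (fun r _ => mulr_sumr _ _ _ _)) /=.
  rewrite -!big_split; apply: eq_bigr => k _; rewrite -!big_split.
  apply: eq_bigr => r _ /=; rewrite /DP factS (natrM _ k`!) (natrM _ n.+1) invfM /=.
  ring.
rewrite !big1 ?addr0 // => k _.
  rewrite (sum_telescope (fun r => (P k r x)`_n) (fun r => derive1n r g (v x))).
  rewrite coef_taylor_increment_expM ?mul0r ?mulr0 // (leq_trans nN) //.
  exact: leq_trans NLv (leq_addl _ _).
rewrite (sum_telescope (fun r => (P r k x)`_n) (fun r => derive1n r f (u x))).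
rewrite coef_taylor_increment_expM ?mul0r ?mulr0 // (leq_trans nN) //.
exact: leq_trans NLu (leq_addr _ _).
Qed.

Lemma derive1n_comp_mul n : (n <= N)%N ->
  forall x, U x -> derive1n n H x = F n x.
Proof.
elim: n => [|n IH] nN x Ux.
  (* In degree 0 only the term [k = r = 0] survives. *)
  rewrite /F (bigD1 ord0) //= (bigD1 ord0) //= !big1.
  - rewrite /P !expr0 mulr1 coef1 /= !addr0 mulr1 divff ?mul1r //.
  - by move=> k k0; rewrite big1 // => r _; rewrite coef_taylor_increment_expM
      ?mulr0 ?mul0r // addn_gt0 lt0n k0.
  - by move=> r r0; rewrite coef_taylor_increment_expM ?mulr0 ?mul0r // lt0n.
have hF := is_derive_composition_sum nN Ux.
(* As [U] is open, the induction hypothesis holds near [x], so it may be differentiated. *)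
rewrite derive1nS derive1E; have [_ <-] := hF; apply: near_eq_derive.
near=> y; apply: IH; first exact: ltnW.
by near: y; exact: open_nbhs_nbhs.
Unshelve. all: by end_near. Qed.

Lemma ntimes_derivable_comp_mul : ntimes_derivable N U H.
Proof.
move=> n x nN Ux; have [dF _] := is_derive_composition_sum nN Ux.
apply: near_eq_derivable dF.
near=> y; apply/esym/derive1n_comp_mul; first exact: ltnW.
by near: y; exact: open_nbhs_nbhs.
Unshelve. all: by end_near. Qed.

End CompositionFormula.

(** * Sums over partitions *)

Lemma elem_sym_gt_size r c : (size c < r)%N -> elem_sym r c = 0%N.
Proof.
move=> cr; rewrite /elem_sym big_pred0 // => I; apply/negbTE.
by rewrite neq_ltn (leq_ltn_trans (max_card _)) // card_ord.
Qed.

Lemma elem_sym_falling_parts_neq0 r s la :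
  elem_sym r (falling_parts s (parts_gt s la)) != 0%N ->
  (r <= size (parts_gt s la))%N.
Proof.
by apply: contra_neqT; rewrite -ltnNge => h; rewrite elem_sym_gt_size ?size_map.
Qed.

Lemma size_parts_gt_sumn s la : (size (parts_gt s la) * s.+1 <= sumn la)%N.
Proof.
elim: la => //= a la IH; case: ifP => [sa|_] /=.
  by rewrite mulSn leq_add.
exact: leq_trans IH (leq_addl _ _).
Qed.

(** At least [r] parts are at least [s.+1], so [r * s.+1 <= n + r * s]. This bounds the outer
    sum. *)
Lemma parts_gt_partition_of n r s la : partition_of (n + r * s) la ->
  (r <= size (parts_gt s la))%N -> (r <= n)%N.
Proof.
move=> [_ _ sla] rla.
have : (r * s.+1 <= n + r * s)%N.
  by rewrite -sla (leq_trans _ (size_parts_gt_sumn s la)) // leq_mul2r rla orbT.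
by rewrite mulnS leq_add2r.
Qed.

(* All partitions of m as soon as m <= M and m < L; the bounds are kept free so
   that they can be chosen independently of r when m = n + r * s. *)
Definition partitions (M L m : nat) : seq (seq nat) :=
  [seq la <- [seq la | l <- index_iota 0 L, la <- bounded_partitions M l]
  | sumn la == m].

Lemma partition_of_bounds m la : partition_of m la ->
  all (fun a => 0 < a <= m)%N la /\ (size la <= m)%N.
Proof.
move=> [_ + <-]; elim: la => //= a la IH; rewrite inE negb_or eq_sym -lt0n.
move=> /andP[a0 /IH[ala sla]]; split.
  rewrite a0 leq_addr /=; apply: sub_all ala => b /andP[-> /= bla].
  exact: leq_trans bla (leq_addl _ _).
by rewrite -add1n leq_add.
Qed.

Lemma partition_ofE M L m : (m <= M)%N -> (m < L)%N ->
  partition_of m = [set` partitions M L m].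
Proof.
move=> mM mL; apply/seteqP; split => la /=; rewrite mem_filter.
  move=> pla; have [ala sla] := partition_of_bounds pla.
  have [la1 la2 la3] := pla; rewrite la3 eqxx /=.
  apply/allpairsPdep; exists (size la), la; split => //.
    by rewrite mem_index_iota /= (leq_ltn_trans sla).
  rewrite mem_bounded_partitions la1 eqxx andbT /=.
  by apply: sub_all ala => a /andP[-> /leq_trans]; exact.
move=> /andP[/eqP sla /allpairsPdep[l [mu [_ + e]]]]; subst mu.
rewrite mem_bounded_partitions => /and3P[so /allP ala _]; split => //.
by apply/negP => /ala.
Qed.

Lemma partitions_uniq M L m : uniq (partitions M L m).
Proof.
rewrite filter_uniq //; apply: allpairs_uniq_dep.
- exact: iota_uniq.
- by move=> l _; exact: bounded_partitions_uniq.
(* The forgotten index [l] is recovered as the length of the partition. *)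
apply: (@can_in_inj _ _ _ _ (fun la => Tagged (fun=> seq nat) (i := size la) la)).
move=> p /allpairsPdep[l [la [_ + ->]]] /=.
by rewrite mem_bounded_partitions => /and3P[_ _ /eqP ->].
Qed.

Lemma finite_partition_pairs n s :
  finite_set [set p : nat * seq nat |
    (p.1 <= n)%N /\ partition_of (n + p.1 * s) p.2].
Proof.
apply: (@sub_finite_set _ _ [set` [seq (r, la) | r <- index_iota 0 n.+1,
  la <- partitions (n + r * s) (n + r * s).+1 (n + r * s)]]); last exact: finite_seq.
move=> [r la] [rn pla]; apply/allpairsPdep; exists r, la; split => //.
  by rewrite mem_index_iota ltnS.
by move: pla; rewrite (partition_ofE (leqnn _) (ltnSn _)).
Qed.

(** The identity 1 / (i - s)! = (i)_s / i! turns the shift by [s] into a weight. No term arises at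
    [i = s] because the increment has no constant term. *)
Lemma taylor_increment_derive1n (K : numFieldType) M s (h : K -> K) x :
  taylor_increment M (derive1n s h) x * 'X^s =
  \sum_(1 <= i < (M + s).+1)
    ((falling_weight s i)%:R * (derive1n i h x / i`!%:R)) *: 'X^i.
Proof.
apply/polyP => i; rewrite coefMXn coef_taylor_increment coef_sum_scaleXn.
rewrite /falling_weight derive1nD subn_gt0 leq_subLR [(s + _)%N]addnC.
have [si|si|<-] := ltngtP s i; rewrite ?mul0r ?if_same //.
rewrite (leq_ltn_trans _ si) //= subnK; last exact: ltnW.
case: ifP => // _; rewrite -(ffact_fact (ltnW si)) natrM invfM.
by rewrite mulrCA mulVKf // pnatr_eq0 -lt0n ffact_gt0 ltnW.
Qed.

Section Terms.
Variables (K : numFieldType) (f g phi : K -> K) (n s : nat) (x : K).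

Lemma term_eq0 r la : elem_sym r (falling_parts s (parts_gt s la)) = 0%N ->
  term f g phi n s r la x = 0.
Proof. by move=> e0; rewrite /term e0 muln0 !mul0r. Qed.

(** Brings [term] to the shape of [coef_partition_sum]: the powers of i! are absorbed into the
    derivatives of [phi]. *)
Lemma term_bounded r m M l la : (m <= M)%N -> la \in bounded_partitions M l ->
  sumn la = m ->
  term f g phi n s r la x =
  n`!%:R * derive1n (l - r) f (phi x) * derive1n r g (derive1n s phi x) *
   ((\prod_(a <- la) (1 + (falling_weight s a)%:R *: 'X))`_r
     * (\prod_(1 <= i < M.+1) (count_mem i la)`!)%:R^-1
     * \prod_(a <- la) (derive1n a phi x / a`!%:R)).
Proof.
move=> mM; rewrite mem_bounded_partitions => /and3P[so ala /eqP sl] e.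
have pla : partition_of m la by split=> //; apply/negP => /(allP ala).
have [alam _] := partition_of_bounds pla.
rewrite /term e sl -elem_sym_falling_parts_coef (prod_exp_count _ alam).
rewrite (prod_fact_count_widen mM alam) big_split /=.
have factE : (\prod_(1 <= i < m.+1) i`! ^ count_mem i la)%N%:R
    = \prod_(a <- la) a`!%:R :> K.
  rewrite natr_prod -(prod_exp_count _ alam).
  by apply: eq_bigr => i _; rewrite natrX.
rewrite (natrM _ n`!) (natrM _ (\prod_(1 <= i < m.+1) _)%N) factE invfM prodf_div.
ring.
Qed.

(** Partitions are grouped by length [k + r]. The bounds on the right do not depend on [r], so that
    the two sums can later be exchanged. *)
Lemma sum_term_partition_of r :
  (r <= n)%N ->
  \sum_(la \in partition_of (n + r * s)) term f g phi n s r la x =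
  \sum_(k < (n + n * s).+1)
   n`!%:R / (k`! * r`!)%:R *
   (taylor_increment (n + n * s + s) phi x ^+ k
     * taylor_increment (n + n * s) (derive1n s phi) x ^+ r)`_n
   * derive1n k f (phi x) * derive1n r g (derive1n s phi x).
Proof.
move=> rn; set M := (n + n * s)%N.
have mM : (n + r * s <= M)%N by rewrite leq_add2l leq_mul2r rn orbT.
have mMs : (n + r * s <= M + s)%N := leq_trans mM (leq_addr _ _).
(* With lengths below [r + M.+1], removing those below [r] leaves exactly [k < M.+1]. *)
have mL : (n + r * s < r + M.+1)%N by rewrite addnS ltnS (leq_trans mM) ?leq_addl.
rewrite (partition_ofE mMs mL) -fsbig_seq ?partitions_uniq // big_filter.
rewrite big_mkcond big_allpairs_dep /= (big_cat_nat (n := r)) ?leq_addr //=.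
(* Fewer than [r] parts force the elementary symmetric function to be 0. *)
rewrite big_nat big1 ?add0r => [|l /andP[_ lr]]; last first.
  rewrite big_seq big1 // => la.
  rewrite mem_bounded_partitions => /and3P[_ _ /eqP sl].
  case: ifP => // _; apply/term_eq0/elem_sym_gt_size.
  by rewrite size_map (leq_ltn_trans _ lr) // -sl size_filter count_size.
rewrite -[X in \sum_(X <= _ < _) _]add0n [(r + _)%N]addnC big_addn addnK big_mkord.
apply: eq_bigr => k _; rewrite -big_mkcond /=.
have rk : (r <= k + r)%N by exact: leq_addl.
have := coef_partition_sum (fun a => derive1n a phi x / a`!%:R)
  (fun a => (falling_weight s a)%:R) (M + s) (n + r * s) rk.
set A := \sum_(1 <= i < (M + s).+1) _; set C := \sum_(1 <= i < (M + s).+1) _.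
have -> : A = taylor_increment (M + s) phi x by [].
(* Each factor [C] contributes ['X^s], which lowers the degree from [n + r * s] to [n]. *)
rewrite /C -taylor_increment_derive1n exprMn -exprM mulrA coefMXn [(s * r)%N]mulnC.
rewrite ltnNge leq_addl /= addnK addnK.
move=> coefE; rewrite big_seq_cond.
rewrite (eq_bigr (fun la =>
   n`!%:R * derive1n k f (phi x) * derive1n r g (derive1n s phi x) *
   ((\prod_(a <- la) (1 + (falling_weight s a)%:R *: 'X))`_r
     * (\prod_(1 <= i < (M + s).+1) (count_mem i la)`!)%:R^-1
     * \prod_(a <- la) (derive1n a phi x / a`!%:R)))); last first.
  by move=> la /andP[laP /eqP sla]; rewrite (term_bounded r mMs laP sla) addnK.
rewrite -big_seq_cond -mulr_sumr -coefE (natrM _ k`!).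
ring.
Qed.

End Terms.

Theorem theorem8 (K : numFieldType) (n s : nat) (f g phi : K -> K)
    (U V W : set K)
    (oU : open U) (oV : open V) (oW : open W)
    (phiV : forall x, U x -> V (phi x))
    (phisW : forall x, U x -> W (derive1n s phi x))
    (df : ntimes_derivable n V f)
    (dg : ntimes_derivable n W g)
    (dphi : ntimes_derivable (n + s) U phi) :
  [/\ ntimes_derivable n U (fun x => f (phi x) * g (derive1n s phi x)),
      finite_set [set p : nat * seq nat |
        partition_of (n + p.1 * s) p.2
        /\ elem_sym p.1 (falling_parts s (parts_gt s p.2)) != 0%N],
      finite_set [set p : nat * seq nat |
        [/\ (p.1 <= n)%N, partition_of (n + p.1 * s) p.2
          & (p.1 <= size (parts_gt s p.2))%N]]
    & forall x, U x ->
        derive1n n (fun y => f (phi y) * g (derive1n s phi y)) x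
          = \sum_(r \in [set: nat]) \sum_(la \in partition_of (n + r * s))
              term f g phi n s r la x
        /\ \sum_(r \in [set: nat]) \sum_(la \in partition_of (n + r * s))
              term f g phi n s r la x
          = \sum_(0 <= r < n.+1)
              \sum_(la \in [set la | partition_of (n + r * s) la
                                     /\ (r <= size (parts_gt s la))%N])
                term f g phi n s r la x].

Proof.
have dpsi := ntimes_derivable_derive1n dphi.
have dphin : ntimes_derivable n U phi := ntimes_derivableW (leq_addr s n) dphi.
have nM : (n <= n + n * s)%N by exact: leq_addr.
have nMs : (n <= n + n * s + s)%N by rewrite -addnA leq_addr.
split.
- exact: (ntimes_derivable_comp_mul oU phiV phisW df dg dphin dpsi
    nMs nM nM (leqnn n)).
- apply: sub_finite_set (finite_partition_pairs n s) => -[r la] /= [pla e0].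
  split=> //; apply: parts_gt_partition_of pla _.
  exact: elem_sym_falling_parts_neq0.
- by apply: sub_finite_set (finite_partition_pairs n s) => -[r la] /= [].
move=> x Ux.
(* For [r > n] all terms vanish, as a nonzero one would give [r] parts larger than [s]. *)
have sumT : \sum_(r \in [set: nat]) \sum_(la \in partition_of (n + r * s))
    term f g phi n s r la x =
    \sum_(0 <= r < n.+1) \sum_(la \in partition_of (n + r * s))
      term f g phi n s r la x.
  rewrite [RHS]fsbig_seq ?iota_uniq //; apply/esym/fsbig_widen => // r [_] /=.
  rewrite mem_index_iota ltnS => /negP; rewrite -ltnNge => nr.
  apply: fsbig1 => la pla; apply: term_eq0; apply/eqP; apply: contraTT nr => e0.
  rewrite -leqNgt; apply: parts_gt_partition_of pla _.
  exact: elem_sym_falling_parts_neq0.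
split.
  rewrite sumT.
  (* The bounds are those of [sum_term_partition_of], with [r] ranging up to [n]. *)
  rewrite (derive1n_comp_mul oU phiV phisW df dg dphin dpsi
    nMs nM nM (leqnn n) (leqnn n) Ux).
  rewrite exchange_big /= big_mkord; apply: eq_bigr => r _.
  by rewrite sum_term_partition_of // -ltnS.
(* The partitions left out have fewer than [r] parts larger than [s], hence zero terms. *)
rewrite sumT; apply: eq_bigr => r _; apply/esym/fsbig_widen => [la []//|la [pla] /=].
move=> npla; apply/term_eq0/eqP; apply/negPn/negP => e0; apply: npla; split => //.
exact: elem_sym_falling_parts_neq0.
Qed.
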